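(* Let $H$ be a Hilbert module over a $C^*$-algebra, and let $Q\in \mathcal{L}(H)$ be an idempotent with matched projection $m(Q)$. Then $$\mathcal{R}\big[m(Q)\big]\cap \mathcal{N}(Q)=\{0\},\quad \mathcal{N}\big[m(Q)\big]\cap \mathcal{R}(Q)=\{0\}.$$
   Context: $\mathcal{L}(H)$ is the $C^*$-algebra of adjointable operators on the Hilbert $C^*$-module $H$, and $I$ is the identity operator on $H$. $\mathcal{R}(\cdot)$ and $\mathcal{N}(\cdot)$ denote range and null space. An idempotent is $Q\in\mathcal{L}(H)$ with $Q^2=Q$; a projection is a self-adjoint idempotent. $P_{\mathcal{R}(Q)}$ is the projection of $H$ onto the (orthogonally complemented) range of $Q$. Definition of the matched projection $m(Q)$ of an idempotent $Q\in\mathcal{L}(H)$: if $Q$ is a projection, $m(Q)=Q$. Otherwise, $H=\mathcal{R}(Q)\dotplus\mathcal{N}(Q^* )$ is an orthogonal decomposition; let $U:H\to\mathcal{R}(Q)\oplus\mathcal{N}(Q^* )$ be the unitary $Uh=\binom{P_{\mathcal{R}(Q)}h}{(I-P_{\mathcal{R}(Q)})h}$, let $I_1$ be the identity on $\mathcal{R}(Q)$, let $A=(Q-P_{\mathcal{R}(Q)})|_{\mathcal{N}(Q^* )}:\mathcal{N}(Q^* )\to\mathcal{R}(Q)$ and $B=(AA^*+I_1)^{1/2}$, and set $$m(Q)=U^*\cdot\frac12\begin{pmatrix}(B+I_1)B^{-1} & B^{-1}A\\ A^*B^{-1} & A^*[B(B+I_1)]^{-1}A\end{pmatrix}\cdot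 U .$$ *)

(* Defs.v *)
From HB Require Import structures.
From mathcomp Require Import all_boot all_order all_algebra.
From mathcomp Require Import all_classical all_reals all_analysis.
From mathcomp Require Import complex.

Set Implicit Arguments.
Unset Strict Implicit.
Unset Printing Implicit Defensive.

Import Order.TTheory GRing.Theory Num.Theory numFieldNormedType.Exports.
Local Open Scope classical_set_scope.
Local Open Scope ring_scope.

(* C*-algebras are complex and not assumed unital, so the product cannot come
   from the ring hierarchy of MathComp. *)
HB.mixin Record isCStarAlgebra (R : realType) A
    of CompleteNormedModule R[i] A := {
  cmul : A -> A -> A;
  cstar : A -> A;
  cmulA : forall a b c, cmul a (cmul b c) = cmul (cmul a b) c;
  cmulDl : forall a b c, cmul (a + b) c = cmul a c + cmul b c;
  cmulDr : forall a b c, cmul a (b + c) = cmul a b + cmul a c;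
  cmulZl : forall (k : R[i]) a b, cmul (k *: a) b = k *: cmul a b;
  cmulZr : forall (k : R[i]) a b, cmul a (k *: b) = k *: cmul a b;
  cnormM : forall a b, `|cmul a b| <= `|a| * `|b|;
  cstarK : forall a, cstar (cstar a) = a;
  cstarD : forall a b, cstar (a + b) = cstar a + cstar b;
  cstarZ : forall (k : R[i]) a, cstar (k *: a) = k^* *: cstar a;
  cstarM : forall a b, cstar (cmul a b) = cmul (cstar b) (cstar a);
  cstar_identity : forall a, `|cmul (cstar a) a| = `|a| ^+ 2
}.

#[short(type="cstarAlgType")]
HB.structure Definition CStarAlgebra (R : realType) :=
  { A of isCStarAlgebra R A & CompleteNormedModule R[i] A }.

Definition cpositive (R : realType) (A : cstarAlgType R) (a : A) : Prop :=
  exists b : A, a = cmul (cstar b) b.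

(* Inner-product (pre-Hilbert) right modules. The inner product is linear in
   the second variable. *)
HB.mixin Record isInnerModule (R : realType) (A : cstarAlgType R) E
    of GRing.Lmodule R[i] E := {
  act : E -> A -> E;
  inner : E -> E -> A;
  actDl : forall x y a, act (x + y) a = act x a + act y a;
  actDr : forall x a b, act x (a + b) = act x a + act x b;
  actM : forall x a b, act x (cmul a b) = act (act x a) b;
  actZl : forall (k : R[i]) x a, act (k *: x) a = k *: act x a;
  actZr : forall (k : R[i]) x a, act x (k *: a) = k *: act x a;
  innerDr : forall x y z, inner x (y + z) = inner x y + inner x z;
  innerZr : forall (k : R[i]) x y, inner x (k *: y) = k *: inner x y;
  inner_act : forall x y a, inner x (act y a) = cmul (inner x y) a;
  inner_star : forall x y, cstar (inner x y) = inner y x;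
  inner_ge0 : forall x, cpositive (inner x x);
  inner_eq0 : forall x, inner x x = 0 -> x = 0
}.

#[short(type="innerModType")]
HB.structure Definition InnerModule (R : realType) (A : cstarAlgType R) :=
  { E of isInnerModule R A E & GRing.Lmodule R[i] E }.

HB.mixin Record isHilbertModule (R : realType) (A : cstarAlgType R) E
    of InnerModule R A E & CompleteNormedModule R[i] E := {
  normr_inner : forall x : E, `|x| ^+ 2 = `|inner x x : A|
}.

#[short(type="hilbertModType")]
HB.structure Definition HilbertModule (R : realType) (A : cstarAlgType R) :=
  { E of isHilbertModule R A E & InnerModule R A E
       & CompleteNormedModule R[i] E }.

Arguments act {R A E} : rename.
Arguments inner {R A E} : rename.

Section InnerTheory.
Variables (R : realType) (A : cstarAlgType R) (E : innerModType A).
Implicit Types x y z : E.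

Lemma cstar_inj : injective (@cstar R A).
Proof. exact: can_inj cstarK. Qed.

Lemma innerDl x y z : inner (x + y) z = inner x z + inner y z.
Proof.
by apply: cstar_inj; rewrite cstarD !inner_star innerDr.
Qed.

Lemma innerZl (k : R[i]) x y : inner (k *: x) y = k^* *: inner x y.
Proof.
by apply: cstar_inj; rewrite cstarZ !inner_star innerZr conjCK.
Qed.

Lemma innerNl x y : inner (- x) y = - inner x y.
Proof. by rewrite -scaleN1r innerZl rmorphN rmorph1 scaleN1r. Qed.

Lemma innerNr x y : inner x (- y) = - inner x y.
Proof. by rewrite -scaleN1r innerZr scaleN1r. Qed.

Lemma innerBr x y z : inner x (y - z) = inner x y - inner x z.
Proof. by rewrite innerDr innerNr. Qed.

Lemma inner0r x : inner x 0 = 0.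
Proof. by rewrite -(scale0r 0) innerZr scale0r. Qed.

Lemma inner_inj x y : (forall z, inner z x = inner z y) -> x = y.
Proof.
move=> h; apply/eqP; rewrite -subr_eq0; apply/eqP/inner_eq0.
by rewrite innerBr h subrr.
Qed.

End InnerTheory.

(* Submodules, as subsets and as inner-product modules of their own. *)
Record submodule (R : realType) (A : cstarAlgType R) (E : innerModType A) := {
  submod_set :> set E;
  submod0 : submod_set 0;
  submodD : forall x y, submod_set x -> submod_set y -> submod_set (x + y);
  submodZ : forall (k : R[i]) x, submod_set x -> submod_set (k *: x);
  submod_act : forall x a, submod_set x -> submod_set (act x a)
}.

Section SubmoduleType.
Variables (R : realType) (A : cstarAlgType R) (E : innerModType A).
Variable K : submodule E.

Definition submod_pred : {pred E} := fun x => x \in submod_set K.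

Lemma submod_predP x : (x \in submod_pred) <-> submod_set K x.
Proof. by split=> [/set_mem|/mem_set]. Qed.

Fact submod_pred_closed : submod_closed submod_pred.
Proof.
split; first by apply/submod_predP; exact: submod0.
move=> k x y /submod_predP hx /submod_predP hy; apply/submod_predP.
by apply: submodD => //; exact: submodZ.
Qed.

HB.instance Definition _ := GRing.isSubmodClosed.Build R[i] E submod_pred
  submod_pred_closed.

Record submod_type := Submod {
  submod_val :> E;
  submod_valP : submod_val \in submod_pred
}.

HB.instance Definition _ := [isSub for submod_val].
HB.instance Definition _ := [Choice of submod_type by <:].
HB.instance Definition _ :=
  [SubChoice_isSubLmodule of submod_type by <:].

Definition mk_submod (x : E) (hx : submod_set K x) : submod_type :=
  Submod (proj2 (submod_predP x) hx).

Lemma submod_type_set (x : submod_type) : submod_set K (submod_val x).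
Proof. exact/submod_predP/submod_valP. Qed.

Definition sub_inner (x y : submod_type) : A :=
  inner (submod_val x) (submod_val y).
Definition sub_act (x : submod_type) (a : A) : submod_type :=
  mk_submod (submod_act a (submod_type_set x)).

Fact sub_actDl x y a : sub_act (x + y) a = sub_act x a + sub_act y a.
Proof. by apply: val_inj; exact: actDl. Qed.
Fact sub_actDr x a b : sub_act x (a + b) = sub_act x a + sub_act x b.
Proof. by apply: val_inj; exact: actDr. Qed.
Fact sub_actM x a b : sub_act x (cmul a b) = sub_act (sub_act x a) b.
Proof. by apply: val_inj; exact: actM. Qed.
Fact sub_actZl (k : R[i]) x a : sub_act (k *: x) a = k *: sub_act x a.
Proof. by apply: val_inj; exact: actZl. Qed.
Fact sub_actZr (k : R[i]) x a : sub_act x (k *: a) = k *: sub_act x a.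
Proof. by apply: val_inj; exact: actZr. Qed.
Fact sub_innerDr x y z : sub_inner x (y + z) = sub_inner x y + sub_inner x z.
Proof. exact: innerDr. Qed.
Fact sub_innerZr (k : R[i]) x y : sub_inner x (k *: y) = k *: sub_inner x y.
Proof. exact: innerZr. Qed.
Fact sub_inner_act x y a : sub_inner x (sub_act y a) = cmul (sub_inner x y) a.
Proof. exact: inner_act. Qed.
Fact sub_inner_star x y : cstar (sub_inner x y) = sub_inner y x.
Proof. exact: inner_star. Qed.
Fact sub_inner_ge0 x : cpositive (sub_inner x x).
Proof. exact: inner_ge0. Qed.
Fact sub_inner_eq0 x : sub_inner x x = 0 -> x = 0.
Proof. by move=> h; apply: val_inj; exact: inner_eq0. Qed.

HB.instance Definition _ := isInnerModule.Build R A submod_type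
  sub_actDl sub_actDr sub_actM sub_actZl sub_actZr
  sub_innerDr sub_innerZr sub_inner_act sub_inner_star
  sub_inner_ge0 sub_inner_eq0.

End SubmoduleType.

(* L(E, F): the adjoint is unique (see [adjoint_uniq]), so carrying it as a
   component adds no data; linearity, A-linearity and boundedness (on complete
   modules) are automatic. *)
Record adjointable (R : realType) (A : cstarAlgType R) (E F : innerModType A)
    := Adjointable {
  adj_fun :> E -> F;
  adj_adj : F -> E;
  adjP : forall x y, inner (adj_fun x) y = inner x (adj_adj y)
}.

Declare Scope adj_scope.
Delimit Scope adj_scope with adj.
Bind Scope adj_scope with adjointable.

Section AdjointableTheory.
Variables (R : realType) (A : cstarAlgType R).
Implicit Types E F G : innerModType A.

Lemma adjoint_uniq E F (S T : adjointable E F) :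
  S =1 T -> adj_adj S =1 adj_adj T.
Proof. by move=> e y; apply: inner_inj => z; rewrite -!adjP e. Qed.

Fact adj_star_subproof E F (T : adjointable E F) x y :
  inner (adj_adj T x) y = inner x (T y).
Proof. by apply: cstar_inj; rewrite !inner_star adjP. Qed.

Definition adj_star E F (T : adjointable E F) : adjointable F E :=
  Adjointable (adj_star_subproof T).

Definition adj_id E : adjointable E E :=
  @Adjointable _ _ E E idfun idfun (fun x y => erefl).

Fact adj_add_subproof E F (S T : adjointable E F) x y :
  inner (S x + T x) y = inner x (adj_adj S y + adj_adj T y).
Proof. by rewrite innerDl innerDr !adjP. Qed.

Definition adj_add E F (S T : adjointable E F) : adjointable E F :=
  Adjointable (adj_add_subproof S T).

Fact adj_comp_subproof E F G (S : adjointable F G) (T : adjointable E F) x y :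
  inner (S (T x)) y = inner x (adj_adj T (adj_adj S y)).
Proof. by rewrite !adjP. Qed.

Definition adj_comp E F G (S : adjointable F G) (T : adjointable E F) :
  adjointable E G := Adjointable (adj_comp_subproof S T).

End AdjointableTheory.

Arguments adj_id {R A E}.
Notation "T ^*" := (adj_star T) : adj_scope.
Notation "S + T" := (adj_add S T) : adj_scope.
Notation "S * T" := (adj_comp S T) : adj_scope.
Notation "1" := adj_id : adj_scope.
Notation "''L' ( E )" := (adjointable E E) (format "''L' ( E )") : type_scope.

Section OperatorNotions.
Variables (R : realType) (A : cstarAlgType R) (E : innerModType A).
Implicit Types S T B : 'L(E).

Definition adj_idempotent T : Prop := (T * T)%adj =1 T.

Definition adj_projection T : Prop := adj_idempotent T /\ (T^*)%adj =1 T.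

(* The positive elements of the C*-algebra L(E). *)
Definition adj_positive T : Prop := exists S : 'L(E), T =1 (S^* * S)%adj.

Definition is_adj_sqrt T B : Prop := adj_positive B /\ (B * B)%adj =1 T.

Definition is_adj_inverse T S : Prop := (T * S)%adj =1 1%adj /\ (S * T)%adj =1 1%adj.

End OperatorNotions.

Section RangeKernel.
Variables (R : realType) (A : cstarAlgType R).
Implicit Types E F : innerModType A.

Lemma adj_starP E F (T : adjointable E F) x y :
  inner x (T^*%adj y) = inner (T x) y.
Proof. by rewrite adjP. Qed.

Lemma adjointableD E F (T : adjointable E F) x y : T (x + y) = T x + T y.
Proof.
apply: inner_inj => z.
by rewrite innerDr -!(adj_star_subproof T) -innerDr.
Qed.

Lemma adjointableZ E F (T : adjointable E F) (k : R[i]) x :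
  T (k *: x) = k *: T x.
Proof.
by apply: inner_inj => z; rewrite innerZr -!(adj_star_subproof T) innerZr.
Qed.

Lemma adjointable_act E F (T : adjointable E F) x (a : A) :
  T (act x a) = act (T x) a.
Proof.
by apply: inner_inj => z; rewrite inner_act -!(adj_star_subproof T) inner_act.
Qed.

Lemma adjointable0 E F (T : adjointable E F) : T 0 = 0.
Proof. by rewrite -(scale0r 0) adjointableZ !scale0r. Qed.

Lemma adjointableB E F (T : adjointable E F) x y : T (x - y) = T x - T y.
Proof. by rewrite adjointableD -scaleN1r adjointableZ scaleN1r. Qed.

Lemma act0 E (a : A) : act (0 : E) a = 0.
Proof. by rewrite -[X in act X _](scale0r (0 : E)) actZl scale0r. Qed.

Section RanNull.
Variables (E F : innerModType A) (T : adjointable E F).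

Fact ran0 : range T 0.
Proof. by exists 0; rewrite ?adjointable0. Qed.
Fact ranD x y : range T x -> range T y -> range T (x + y).
Proof. by case=> u _ <- [v _ <-]; exists (u + v); rewrite ?adjointableD. Qed.
Fact ranZ (k : R[i]) x : range T x -> range T (k *: x).
Proof. by case=> u _ <-; exists (k *: u); rewrite ?adjointableZ. Qed.
Fact ran_act x (a : A) : range T x -> range T (act x a).
Proof. by case=> u _ <-; exists (act u a); rewrite ?adjointable_act. Qed.

Definition ran : submodule F := Build_submodule ran0 ranD ranZ ran_act.

Fact nullD x y : T x = 0 -> T y = 0 -> T (x + y) = 0.
Proof. by rewrite adjointableD => -> ->; rewrite addr0. Qed.
Fact nullZ (k : R[i]) x : T x = 0 -> T (k *: x) = 0.
Proof. by rewrite adjointableZ => ->; rewrite scaler0. Qed.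
Fact null_act x (a : A) : T x = 0 -> T (act x a) = 0.
Proof. by rewrite adjointable_act => ->; rewrite act0. Qed.

Definition null : submodule E :=
  @Build_submodule _ _ E [set x | T x = 0] (adjointable0 T) nullD nullZ null_act.

End RanNull.

End RangeKernel.

Section MatchedProjection.
Variables (R : realType) (A : cstarAlgType R) (H : hilbertModType A).
Implicit Types (Q P M : 'L(H)).

(* P is P_{R(Q)}. *)
Definition is_range_proj Q P : Prop :=
  adj_projection P /\ range P = range Q.

Section Data.
Variables (Q P : 'L(H)).
Hypotheses (hQ : adj_idempotent Q) (hP : is_range_proj Q P).

Local Notation RQ := (submod_type (ran Q)).
Local Notation NQ := (submod_type (null Q^*)).

Lemma range_proj_mem h : range Q (P h).
Proof. by case: hP => _ <-; exists h. Qed.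

Lemma range_proj_id x : range Q x -> P x = x.
Proof. by case: hP => [[hPP _] <-] [y _ <-]; exact: hPP. Qed.

Lemma idempotent_range_id x : range Q x -> Q x = x.
Proof. by case=> y _ <-; exact: hQ. Qed.

Lemma range_projC_mem h : (Q^*)%adj (h - P h) = 0.
Proof.
have [[_ hsP] _] := hP.
apply: inner_inj => z; rewrite inner0r.
rewrite adj_starP innerBr.
rewrite -[P h]hsP adj_starP.
by rewrite range_proj_id ?subrr//; exists z.
Qed.

Lemma null_star_proj (y : NQ) : P (submod_val y) = 0.
Proof.
have [[_ hsP] _] := hP.
apply: inner_inj => z; rewrite inner0r.
rewrite -[P _]hsP adj_starP.
have [w _ <-] := range_proj_mem z.
rewrite -adj_starP.
by have := submod_type_set y; rewrite /= => ->; rewrite inner0r.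
Qed.

Definition matched_U (h : H) : RQ * NQ :=
  (@mk_submod _ _ _ (ran Q) (P h) (range_proj_mem h),
   @mk_submod _ _ _ (null Q^*) (h - P h) (range_projC_mem h)).

Definition matched_Ustar (z : RQ * NQ) : H :=
  submod_val z.1 + submod_val z.2.

Lemma matched_U_adjoint h z :
  inner (matched_U h).1 z.1 + inner (matched_U h).2 z.2
  = inner h (matched_Ustar z).
Proof.
have [[_ hsP] _] := hP.
case: z => x y; rewrite /matched_Ustar /= innerDr; congr (_ + _).
  rewrite [LHS](_ : _ = inner (P h) (submod_val x))//.
  rewrite -adj_starP hsP range_proj_id//.
  exact: (submod_type_set x).
rewrite [LHS](innerDl h) innerNl -adj_starP hsP null_star_proj.
by rewrite inner0r subr0.
Qed.

Lemma matched_UK : cancel matched_U matched_Ustar.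
Proof. by move=> h; rewrite /matched_Ustar /= addrC subrK. Qed.

Lemma matched_UstarK : cancel matched_Ustar matched_U.
Proof.
move=> [x y]; have Pxy : P (submod_val x + submod_val y) = submod_val x.
  rewrite adjointableD null_star_proj addr0.
  by apply: range_proj_id; exact: (submod_type_set x).
congr pair; apply: val_inj; rewrite /= /matched_Ustar /= Pxy//.
by rewrite addrC addKr.
Qed.

Fact matched_A_mem (y : NQ) :
  range Q (Q (submod_val y) - P (submod_val y)).
Proof. by rewrite null_star_proj subr0; exists (submod_val y). Qed.

Fact matched_A_adj_mem (x : RQ) :
  (Q^*)%adj ((Q^*)%adj (submod_val x) - (P^*)%adj (submod_val x)) = 0.
Proof.
have [[_ hsP] _] := hP.
rewrite hsP range_proj_id; last exact: (submod_type_set x).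
apply: inner_inj => z.
rewrite inner0r adj_starP innerBr adj_starP.
by rewrite [Q (Q z)]hQ subrr.
Qed.

Definition matched_A_fun (y : NQ) : RQ :=
  @mk_submod _ _ _ (ran Q) _ (matched_A_mem y).
Definition matched_A_adj (x : RQ) : NQ :=
  @mk_submod _ _ _ (null Q^*) _ (matched_A_adj_mem x).

Fact matched_A_subproof y x :
  inner (matched_A_fun y) x = inner y (matched_A_adj x).
Proof.
rewrite [LHS](innerDl (Q (submod_val y))) innerNl !adjP.
by rewrite -innerBr.
Qed.

(* A = (Q - P_{R(Q)})|_{N(Q^* )} : N(Q^* ) -> R(Q). *)
Definition matched_A : adjointable NQ RQ := Adjointable matched_A_subproof.

End Data.

Definition block_op (E F : innerModType A) (a : 'L(E)) (b : adjointable F E)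
    (c : adjointable E F) (d : 'L(F)) (z : E * F) : E * F :=
  (a z.1 + b z.2, c z.1 + d z.2).

(* M = m(Q) for the idempotent Q. In the second case the projection P_{R(Q)},
   the square root B, its inverse Bi and the inverse Ci of B(B + I_1) are each
   unique, so M is determined by Q. *)
Definition is_matched_projection Q (hQ : adj_idempotent Q) M : Prop :=
  (adj_projection Q /\ M =1 Q) \/
  (~ adj_projection Q /\
   exists P (hP : is_range_proj Q P) (B Bi Ci : 'L(submod_type (ran Q))),
     let A_ := matched_A hQ hP in
     [/\ is_adj_sqrt (A_ * A_^* + 1)%adj B,
         is_adj_inverse B Bi,
         is_adj_inverse (B * (B + 1))%adj Ci &
         forall h, M h = matched_Ustar (2^-1 *:
           block_op ((B + 1) * Bi)%adj (Bi * A_)%adj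
                    (A_^* * Bi)%adj (A_^* * Ci * A_)%adj (matched_U hP h))]).

End MatchedProjection.

(* Main.v *)
(** In the decomposition R(Q) + N(Q^* ) the idempotent is [Q (x, y) = x + A y].
    Since (B + 1) [B (B + 1)]^-1 = B^-1, every vector of R(m(Q)) has the form
    1/2 ((B + 1) w, A^* w) with w in R(Q); as A A^* = B^2 - 1, applying Q to it
    gives 1/2 B (B + 1) w, which vanishes only for w = 0. For x in R(Q), the
    first component of m(Q) x is 1/2 (B + 1) B^-1 x, so m(Q) x = 0 forces
    x = 0. *)
Require Import Defs.
From mathcomp Require Import all_boot all_order all_algebra.
From mathcomp Require Import all_classical all_reals all_analysis.
From mathcomp Require Import complex.

Import GRing.Theory Num.Theory.
Local Open Scope classical_set_scope.
Local Open Scope ring_scope.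

Lemma idempotent_ran_null0 (R : realType) (A : cstarAlgType R)
    (E : innerModType A) (Q : 'L(E)) (hQ : adj_idempotent Q) h :
  range Q h -> Q h = 0 -> h = 0.
Proof. by case=> k _ <-; rewrite [Q (Q k)]hQ. Qed.

Section MatchedNontrivial.
Variables (R : realType) (A : cstarAlgType R) (H : hilbertModType A).
Variables (Q P : 'L(H)) (hQ : adj_idempotent Q) (hP : is_range_proj Q P).
Let T := matched_A hQ hP.
Variables B Bi Ci : 'L(submod_type (ran Q)).
Hypothesis hB : (B * B)%adj =1 (T * T^* + 1)%adj.
Hypothesis hBi : is_adj_inverse B Bi.
Hypothesis hCi : is_adj_inverse (B * (B + 1))%adj Ci.

Let M (h : H) := matched_Ustar (2^-1 *:
  block_op ((B + 1) * Bi)%adj (Bi * T)%adj (T^* * Bi)%adj (T^* * Ci * T)%adj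
    (matched_U hP h)).

(** [Ci] is a left inverse of B (B + 1). Both intersections are reduced to this injectivity. *)
Lemma BB1_inj0 w : B (B w + w) = 0 -> w = 0.
Proof. by move=> Bw0; rewrite -[w]hCi.2 /= Bw0 adjointable0. Qed.

(** [Q] fixes its range, and A agrees with [Q] on N(Q^* ) because [P] vanishes there. *)
Lemma idempotent_matched_Ustar x y :
  Q (matched_Ustar (x, y)) = submod_val (x + T y).
Proof.
rewrite /matched_Ustar /= adjointableD (null_star_proj hP) subr0.
by rewrite (idempotent_range_id hQ (submod_type_set x)).
Qed.

Lemma matched_formula_range k : exists w,
  M k = matched_Ustar (2^-1 *: (B w + w), 2^-1 *: T^*%adj w).
Proof.
set x := (matched_U hP k).1; set y := (matched_U hP k).2.
(* Read off the second row of the block matrix by factoring out A^* on the left. *)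
exists (Bi x + Ci (T y)).
(* Cancel B on the left in B (B + 1) [Ci] = 1. *)
have BiE v : Bi v = B (Ci v) + Ci v.
  by rewrite -{1}[v]hCi.1; apply: hBi.2.
rewrite /M; congr matched_Ustar; congr (_ *: _, _ *: _).
  transitivity (B (Bi x) + Bi x + Bi (T y)) => //.
  by rewrite (BiE (T y)) adjointableD addrACA.
transitivity (T^*%adj (Bi x) + T^*%adj (Ci (T y))) => //.
by rewrite -(adjointableD T^*%adj).
Qed.

Lemma matched_formula_ran_null0 k : Q (M k) = 0 -> M k = 0.
Proof.
have [w ->] := matched_formula_range k.
rewrite idempotent_matched_Ustar adjointableZ -scalerDr => e.
have /eqP : 2^-1 *: (B w + w + T (T^*%adj w)) = 0 by apply: val_inj.
rewrite scaler_eq0 invr_eq0 pnatr_eq0 orFb => /eqP e'.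
have w0 : w = 0.
  (* Since B^2 = A A^* + 1, the vector in [e'] is B (B w + w) with its terms reordered. *)
  apply: BB1_inj0; rewrite adjointableD [B (B w)]hB -[RHS]e'.
  by rewrite [LHS]addrC -addrA [w + _]addrC.
have Bw0 : B w + w = 0 by rewrite w0 adjointable0 addr0.
have Tw0 : T^*%adj w = 0 by rewrite w0 (adjointable0 T^*%adj).
by rewrite Bw0 Tw0 !scaler0 /matched_Ustar addr0.
Qed.

Lemma matched_formula_null_ran0 x : range Q x -> M x = 0 -> x = 0.
Proof.
move=> hx Mx0.
pose x1 := (matched_U hP x).1.
have x1E : submod_val x1 = x by apply: (range_proj_id hP hx).
(* With no component in N(Q^* ), only the first column of the block matrix acts on [x]. *)
have y0 : (matched_U hP x).2 = 0.
  by apply: val_inj; rewrite /= (range_proj_id hP hx) subrr.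
have /(congr1 (matched_U hP)) := Mx0.
rewrite /M matched_UstarK => /(congr1 fst) e.
have /eqP : 2^-1 *: (B (Bi x1) + Bi x1) = 0.
  transitivity (matched_U hP 0).1; last first.
    by apply: val_inj; rewrite /= adjointable0.
  rewrite -e; congr (_ *: _).
  by rewrite -[LHS]addr0; congr (_ + _); rewrite y0 !adjointable0.
rewrite scaler_eq0 invr_eq0 pnatr_eq0 orFb => /eqP e'.
(* B + 1 kills [Bi x1], hence so does B (B + 1). *)
have u0 : Bi x1 = 0 by apply: BB1_inj0; rewrite e' adjointable0.
by rewrite -x1E -[x1]hBi.1 /= u0 adjointable0.
Qed.

End MatchedNontrivial.

Theorem corollary3p15 (R : realType) (A : cstarAlgType R)
    (H : hilbertModType A) (Q : 'L(H)) (hQ : adj_idempotent Q)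
    (mQ : 'L(H)) (hmQ : is_matched_projection hQ mQ) :
  (ran mQ : set H) `&` (null Q : set H) = [set 0] /\
  (null mQ : set H) `&` (ran Q : set H) = [set 0].
Proof.
suff [h1 h2] : (forall k, Q (mQ k) = 0 -> mQ k = 0) /\
    (forall x, range Q x -> mQ x = 0 -> x = 0).
  split; apply/seteqP; split => x /=.
  - by move=> [[k _ <-]]; exact: h1.
  - by move=> ->; split; [exact: ran0 | exact: adjointable0].
  - by move=> [mx0 Qx]; exact: h2.
  - by move=> ->; split; [exact: adjointable0 | exact: ran0].
case: hmQ => [[_ mE]|[_ [P [hP [B [Bi [Ci [[_ hB] hBi hCi mE]]]]]]]].
  (* For a projection, m(Q) = Q and both claims say that R(Q) meets N(Q) trivially. *)
  split=> [k|x Qx]; rewrite mE; first by rewrite [Q (Q k)]hQ.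
  exact: idempotent_ran_null0.
split=> [k|x Qx]; rewrite mE.
  exact: matched_formula_ran_null0 hB hBi hCi k.
exact: matched_formula_null_ran0 hBi hCi x Qx.
Qed.
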